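(* Consider a memory-$1$ stochastic temporal graph on $G=(V,E)$ and a target vertex $y\in V$. For $a\in V$ and $G'\subseteq G$ let $h(a,y,G')$ be the minimum, over all policies, of the expected arrival time at $y$ when Alice starts at vertex $a$ at time $0$ and the initial snapshot is $G_0=G'$. Let $\sigma^*$ be an ordering of all pairs $(a,G')$, $a\in V$, $G'\subseteq G$, in nondecreasing order of $h(a,y,G')$ (ties broken arbitrarily). For $a\in V$ and $G_1\subseteq G$, let $u^{\sigma^*}_{a,G_1}$ be the vertex $u\in\Gamma_{G_1}[a]$ such that $(u,G_1)$ appears in $\sigma^*$ before $(u',G_1)$ for every $u'\in\Gamma_{G_1}[a]\setminus\{u\}$. Let $(h'(a,y,G_0): a\in V, G_0\subseteq G)$ be any real vector satisfying: (i) $h'(a,y,G_0)=1+\sum_{G_1\subseteq G}\mu(G_1\mid G_0)\,h'(u^{\sigma^*}_{a,G_1},y,G_1)$ for all $a\in V\setminus\{y\}$ and $G_0\subseteq G$; (ii) $h'(u^{\sigma^*}_{a,G_1},y,G_1)\leq h'(u,y,G_1)$ for all $a\in V\setminus\{y\}$, $G_1\subseteq G$ and $u\in\Gamma_{G_1}[a]$; (iii) $h'(a,y,G_0)\geq0$ for all $a\in V$, $G_0\subseteq G$; (iv) $h'(y,y,G_0)=0$ for all $G_0\subseteq G$. Then $h'(a,y,G_0)=h(a,y,G_0)$ for all $a\in V$ and $G_0\subseteq G$.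
   Context: A memory-$1$ stochastic temporal graph on $G=(V,E)$ has an initial snapshot $G_0\subseteq G$ and, for every edge $e$, numbers $p_e,q_e\in[0,1]$: for each $t\ge1$, independently over edges, an edge absent in $G_{t-1}$ appears in $G_t$ with probability $p_e$, and an edge present in $G_{t-1}$ is absent in $G_t$ with probability $q_e$. $\mu(G''\mid G')$ denotes the probability that the next snapshot is $G''$ given that the current snapshot is $G'$. $\Gamma_{H}[v]$ is the closed neighbourhood of $v$ in $H$ ($v$ together with its neighbours in $H$). A policy for Alice: at each time $t\geq0$, with Alice at vertex $a_t$ and the next snapshot $G_{t+1}$ revealed, she chooses $a_{t+1}\in\Gamma_{G_{t+1}}[a_t]$; once at $y$ she stays. Her arrival time is the first $t$ with $a_t=y$. *)

(* Defs.v *)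
From HB Require Import structures.
From mathcomp Require Import all_boot all_order all_algebra.
From mathcomp Require Import all_classical all_reals all_analysis.

Set Implicit Arguments.
Unset Strict Implicit.
Unset Printing Implicit Defensive.

Import Order.TTheory GRing.Theory Num.Theory.

Local Open Scope ring_scope.

Record sgraph (V : finType) := SGraph {
  edges : {set {set V}};
  edges_card2 : forall e, e \in edges -> #|e| = 2%N }.

Definition edge (V : finType) (G : sgraph V) : finType :=
  {e : {set V} | e \in edges G}.

(* A snapshot G' of G has the same vertices as G, so it is given by its set of
   edges; the members of this type are exactly the subgraphs G' of G. *)
Notation snapshot G := {set edge G}.

Definition adjacent (V : finType) (G : sgraph V) (H : snapshot G) (v w : V) :=
  [exists e in H, val e == [set v; w]].

Definition closed_nbhd (V : finType) (G : sgraph V) (H : snapshot G) (v : V)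
  : {set V} := v |: [set w | adjacent H v w].

Record memory1 (R : realType) (V : finType) (G : sgraph V) := Memory1 {
  p_birth : edge G -> R;
  q_death : edge G -> R;
  p_birth01 : forall e, 0 <= p_birth e <= 1;
  q_death01 : forall e, 0 <= q_death e <= 1 }.

Section Memory1.
Context (R : realType) (V : finType) (G : sgraph V).

(* [mu D G' G''] is the probability written mu(G'' | G'), conditioning snapshot
   first. *)
Definition mu (D : memory1 R G) (G' G'' : snapshot G) : R :=
  \prod_(e : edge G)
    if e \in G' then (if e \in G'' then 1 - q_death D e else q_death D e)
    else (if e \in G'' then p_birth D e else 1 - p_birth D e).

(* The random snapshots [X t] live on one probability space, with one
   probability [P g] for each initial snapshot [g].  The last clause is the
   law of [X t.+1] conditionally on the whole past, in the multiplied-out form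
   that remains meaningful when the past has probability 0. *)
Record memory1_process (D : memory1 R G) d (Om : measurableType d)
    (P : snapshot G -> probability Om R) (X : nat -> Om -> snapshot G) : Prop :=
  Memory1Process {
    process_measurable : forall t g, measurable [set w | X t w = g]%classic;
    process_init : forall g, P g [set w | X 0%N w = g]%classic = 1%E;
    process_step : forall g (s : nat -> snapshot G) t,
      P g [set w | forall i, (i <= t.+1)%N -> X i w = s i]%classic =
      (P g [set w | forall i, (i <= t)%N -> X i w = s i]%classic *
       (mu D (s t) (s t.+1))%:E)%E }.

(* [choose past a g g1] is the vertex chosen for time t+1, where [past] lists
   the states (a_i, G_i) for i < t in chronological order (so t = size past),
   a = a_t, g = G_t, and g1 = G_{t+1} is the revealed next snapshot. *)
Record policy (y : V) := Policy {
  choose : seq (V * snapshot G) -> V -> snapshot G -> snapshot G -> V;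
  choose_nbhd : forall past a g g1, choose past a g g1 \in closed_nbhd g1 a;
  choose_stay : forall past g g1, choose past y g g1 = y }.

(* The states before time t, and the position at time t, of Alice when she
   starts at a and the successive snapshots are s 0, s 1, and so on. *)
Fixpoint run (y : V) (pi : policy y) (a : V) (s : nat -> snapshot G) (t : nat)
  : seq (V * snapshot G) * V :=
  if t is t'.+1 then
    let: (past, b) := run pi a s t' in
    (rcons past (b, s t'), choose pi past b (s t') (s t'.+1))
  else ([::], a).

Definition position (y : V) (pi : policy y) (a : V) (s : nat -> snapshot G)
  (t : nat) : V := (run pi a s t).2.

(* This is +oo when y is never reached. *)
Definition arrival_time (y : V) (pi : policy y) (a : V) (s : nat -> snapshot G)
  : \bar R :=
  ereal_inf [set (t%:R)%:E | t in [set t : nat | position pi a s t = y]]%classic.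

Section Expectation.
Context d (Om : measurableType d) (P : snapshot G -> probability Om R)
  (X : nat -> Om -> snapshot G).

(* The integral is written out because [expectation] only applies to
   real-valued random variables. *)
Definition expected_arrival (y : V) (pi : policy y) (a : V) (g : snapshot G)
  : \bar R :=
  (\int[P g]_w arrival_time pi a (fun t => X t w))%E.

(* The minimum over all policies, as an infimum so that it is defined without
   presupposing an optimal policy. *)
Definition hopt (a y : V) (g : snapshot G) : \bar R :=
  ereal_inf (range (fun pi : policy y => expected_arrival pi a g)).

Definition is_optimal_ordering (y : V) (sigma : seq (V * snapshot G)) : Prop :=
  perm_eq sigma (enum {: V * snapshot G}) /\
  sorted (fun x x' => hopt x.1 y x.2 <= hopt x'.1 y x'.2)%E sigma.

End Expectation.

Definition is_first_neighbour (sigma : seq (V * snapshot G)) (a : V)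
    (g1 : snapshot G) (u : V) : Prop :=
  u \in closed_nbhd g1 a /\
  forall u', u' \in closed_nbhd g1 a :\ u ->
    (index (u, g1) sigma < index (u', g1) sigma)%N.

End Memory1.

(* Main.v *)
(* The expected arrival time of a policy is the sum over t of the probabilities
   miss(t) = P(a_t <> y).  For the policy that moves to u(a_t, G_{t+1}),
   hypotheses (i) and (iv) give
     h'(a, y, g) = miss(0) + ... + miss(t-1) + E[h'(a_t, y, G_t)],
   and h' >= 0 bounds its expected arrival time by h'(a, y, g).  For an arbitrary
   policy (ii) turns the equality into <=, and the last term is at most
   C * miss(t), which is arbitrarily small for some t unless the expected arrival
   time is infinite. *)
Require Import Defs.
From HB Require Import structures.
From mathcomp Require Import all_boot all_order all_algebra.
From mathcomp Require Import all_classical all_reals all_analysis measurable_realfun.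

Set Implicit Arguments.
Unset Strict Implicit.
Unset Printing Implicit Defensive.

Import Order.TTheory GRing.Theory Num.Theory.

Local Open Scope ring_scope.

(** * Integrals of functions of finitely many terms of a finite-state process *)

Definition determined_upto (S T : Type) (t : nat) (f : (nat -> S) -> T) :=
  forall s s' : nat -> S, (forall i, (i <= t)%N -> s i = s' i) -> f s = f s'.

(** Only the value at [t.+1] of the constant tail matters: this appends [x] as next state to the
    prefix up to [t]. *)
Definition splice (S : Type) (s : nat -> S) (t : nat) (x : S) : nat -> S :=
  fun i => if (i <= t)%N then s i else x.

Section FiniteStateSequences.
Context (R : realType) (S : finType) (d : measure_display)
  (Om : measurableType d) (X : nat -> Om -> S).
Hypothesis measurable_X : forall t x, measurable [set w | X t w = x]%classic.

Definition cylinder (t : nat) (s : nat -> S) : set Om :=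
  [set w | forall i, (i <= t)%N -> X i w = s i]%classic.

Lemma measurable_cylinder t s : measurable (cylinder t s).
Proof.
rewrite (_ : cylinder t s = \bigcap_(i in `I_t.+1) [set w | X i w = s i])%classic.
  by apply: fin_bigcap_measurable => // i _; exact: measurable_X.
by apply/seteqP; split => w /= h i; have := h i; rewrite /= ltnS.
Qed.

(** The index type is arbitrary so that it can be a set of prefixes, or of pairs (prefix, next
    state) when a partition is refined by one step. *)
Definition partition_upto (I : finType) (t : nat) (c : I -> nat -> S) :=
  forall w, exists i, forall j, (w \in cylinder t (c j)) = (j == i).

Lemma sum_cylinders (I : finType) t (c : I -> nat -> S) (f : (nat -> S) -> R) w :
  partition_upto t c -> determined_upto t f ->
  (f (X^~ w))%:E = (\sum_i (f (c i) * \1_(cylinder t (c i)) w)%:E)%E.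
Proof.
move=> /(_ w)[i ci] ft; rewrite (bigD1 i) //= big1 ?adde0 => [|j ji].
  rewrite indicE ci eqxx mulr1; congr EFin; apply: ft => j jt.
  by have := ci i; rewrite eqxx => /set_mem /(_ j jt).
by rewrite indicE ci (negPf ji) mulr0.
Qed.

Lemma measurable_cylinder_term (A : set Om) (r : R) :
  measurable A -> measurable_fun setT (fun w => (r * \1_A w)%:E : \bar R).
Proof.
by move=> mA; apply/measurable_EFinP; apply: measurable_funM => //; exact: measurable_indic.
Qed.

(** Beyond [t], [inord] falls back to index 0; these values are harmless because cylinders up to [t]
    ignore them. *)
Lemma ordinal_partition t :
  partition_upto t (fun (x : {ffun 'I_t.+1 -> S}) i => x (inord i)).
Proof.
move=> w; exists [ffun i : 'I_t.+1 => X i w] => x; apply/idP/eqP => [|->].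
  move=> /set_mem xw; apply/ffunP => i; rewrite ffunE.
  by rewrite xw ?inord_val // -ltnS.
by apply/mem_set => i it; rewrite ffunE inordK.
Qed.

Lemma splice_partition (I : finType) t (c : I -> nat -> S) :
  partition_upto t c ->
  partition_upto t.+1 (fun ix : I * S => splice (c ix.1) t ix.2).
Proof.
move=> pc w; have [i ci] := pc w; exists (i, X t.+1 w) => -[j x] /=.
rewrite xpair_eqE -ci; apply/idP/andP.
  move=> /set_mem jw; split.
    by apply/mem_set => k kt; rewrite (jw k (leqW kt)) /splice kt.
  by rewrite (jw _ (leqnn _)) /splice ltnn.
move=> [/set_mem jw /eqP ->]; apply/mem_set => k.
by rewrite leq_eqVlt ltnS /splice => /orP[/eqP ->|kt]; rewrite ?ltnn // kt jw.
Qed.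

Lemma measurable_path_function t (f : (nat -> S) -> R) : determined_upto t f ->
  measurable_fun setT (fun w => (f (X^~ w))%:E : \bar R).
Proof.
move=> ft; under eq_fun do rewrite (sum_cylinders _ (ordinal_partition t) ft).
by apply: emeasurable_sum => i; exact/measurable_cylinder_term/measurable_cylinder.
Qed.

(** The integrand is constant on each cylinder, so it is a finite combination of indicators. *)
Lemma integral_cylinders (m : {measure set Om -> \bar R}) (I : finType) t
    (c : I -> nat -> S) (f : (nat -> S) -> R) :
  partition_upto t c -> determined_upto t f -> (forall s, 0 <= f s) ->
  (\int[m]_w (f (X^~ w))%:E = \sum_i (f (c i))%:E * m (cylinder t (c i)))%E.
Proof.
move=> pc ft f0; under eq_integral do rewrite (sum_cylinders _ pc ft).
rewrite ge0_integral_sum //; first last.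
- by move=> i w _; rewrite lee_fin mulr_ge0 // indicE ler0n.
- by move=> i; exact/measurable_cylinder_term/measurable_cylinder.
apply: eq_bigr => i _; under eq_integral do rewrite EFinM.
rewrite ge0_integralZl_EFin //.
- rewrite integral_indic ?setIT //; exact: measurable_cylinder.
- apply/measurable_EFinP/measurable_indic/measurable_cylinder.
Qed.

End FiniteStateSequences.

(** * The arrival time as a number of misses *)

Section Policies.
Context (R : realType) (V : finType) (G : sgraph V) (y : V).
Implicit Types (pi : @policy V G y) (s : nat -> snapshot G).

Lemma run_determined pi a t : determined_upto t (fun s => run pi a s t).
Proof.
elim: t => [//|t IH] s s' ss'; rewrite /= (IH s s') => [|i it].
  by rewrite !ss'.
by rewrite ss' // leqW.
Qed.

Lemma position_determined pi a t : determined_upto t (fun s => position pi a s t).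
Proof. by move=> s s' /(@run_determined pi a t); rewrite /position => ->. Qed.

Lemma position_next pi a s t :
  position pi a s t.+1 = Defs.choose pi (run pi a s t).1 (position pi a s t) (s t) (s t.+1).
Proof. by rewrite /position /=; case: run. Qed.

Lemma position_stays pi a s t t' : (t <= t')%N ->
  position pi a s t = y -> position pi a s t' = y.
Proof.
move=> /subnK <- yt; elim: (t' - t)%N => // k IH.
by rewrite addSn position_next IH choose_stay.
Qed.

(** Since Alice stays at [y], the terms are 1 before the first visit and 0 from then on. *)
Lemma arrival_time_series pi a s :
  arrival_time R pi a s = (\sum_(0 <= t <oo) ((position pi a s t != y)%:R : R)%:E)%E.
Proof.
have n0 t : (0 <= ((position pi a s t != y)%:R : R)%:E)%E by rewrite lee_fin ler0n.
have [ex|nex] := pselect (exists t, position pi a s t == y); last first.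
  have one t : (position pi a s t != y)%:R = 1 :> R.
    by case: eqP => // /eqP yt; case: nex; exists t.
  (* If [y] is never reached, the infimum over the empty set is [+oo], and the partial sums, equal
     to [n], exceed every real. *)
  rewrite /arrival_time (_ : [set t | _]%classic = set0) ?image_set0 ?ereal_inf0.
    apply/esym/eqyP => r r0.
    pose n := Num.Def.archi_bound r.
    apply: (@le_trans _ _ (\sum_(0 <= t < n) ((position pi a s t != y)%:R : R)%:E)%E); last first.
      exact: nneseries_lim_ge.
    rewrite sumEFin lee_fin (eq_bigr (fun=> 1)) // sumr_const_nat subn0.
    exact/ltW/archi_boundP/ltW.
  by apply/seteqP; split => t //= /eqP yt; case: nex; exists t.
case: (ex_minnP ex) => n /eqP yn nmin.
rewrite (nneseries_split 0 n) // add0n [X in (_ + X)%E]eseries0 ?adde0; last first.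
  by move=> i ni _; rewrite (position_stays ni yn) eqxx.
rewrite sumEFin big_nat (eq_bigr (fun=> 1)) => [|i /= ni]; last first.
  by case: eqP => // /eqP /nmin; rewrite leqNgt ni.
rewrite -big_nat sumr_const_nat subn0; apply/le_anti/andP; split.
  by apply: ereal_inf_lbound; exists n.
by apply/ereal_infP => _ [t /= /eqP /nmin nt <-]; rewrite lee_fin ler_nat.
Qed.

End Policies.

(** * The Markov property in integrated form *)

Section Process.
Context (R : realType) (V : finType) (G : sgraph V) (D : memory1 R G)
  (d : measure_display) (Om : measurableType d)
  (P : snapshot G -> probability Om R) (X : nat -> Om -> snapshot G)
  (procX : memory1_process D P X).

Let mX := process_measurable procX.

Lemma mu_ge0 g0 g1 : 0 <= mu D g0 g1.
Proof.
apply: prodr_ge0 => e _.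
have /andP[p0 p1] := p_birth01 D e; have /andP[q0 q1] := q_death01 D e.
by case: ifP => _; case: ifP => _ //; rewrite subr_ge0.
Qed.

(** Splitting each cylinder up to [t] by the next snapshot [h], [process_step] factors its
    probability as that of the prefix times [mu]. *)
Lemma integral_step g t (f : (nat -> snapshot G) -> R) :
  determined_upto t.+1 f -> (forall s, 0 <= f s) ->
  (\int[P g]_w (f (X^~ w))%:E =
   \int[P g]_w (\sum_h mu D (X t w) h * f (splice (X^~ w) t h))%:E)%E.
Proof.
move=> ft f0.
have pt := ordinal_partition X t.
rewrite (integral_cylinders mX (P g) (splice_partition pt) ft f0).
pose F s := \sum_h mu D (s t) h * f (splice s t h).
have Ft : determined_upto t F.
  move=> s s' ss'; apply: eq_bigr => h _; rewrite ss' //; congr (_ * _).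
  by apply: ft => i _; rewrite /splice; case: ifP => // /ss'.
have F0 s : 0 <= F s by apply: sumr_ge0 => h _; rewrite mulr_ge0 ?mu_ge0.
rewrite (integral_cylinders mX (P g) pt Ft F0) -(pair_bigA _
  (fun (x : {ffun 'I_t.+1 -> snapshot G}) h =>
    (f (splice (fun k => x (inord k)) t h))%:E *
    P g (cylinder X t.+1 (splice (fun k => x (inord k)) t h)))%E) /=.
apply: eq_bigr => x _.
set s := fun k => x (inord k).
(* Finiteness allows the remaining identity to be checked in [R], where the product distributes over
   the sum. *)
have Pt : P g (cylinder X t s) \is a fin_num.
  by rewrite fin_num_measure //; exact: measurable_cylinder.
rewrite -(fineK Pt) /F -EFinM mulr_suml -sumEFin; apply: eq_bigr => h _.
rewrite [X in (_ * X)%E](process_step procX).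
rewrite (_ : [set w | _]%classic = cylinder X t s); last first.
  by apply/seteqP; split => w /= sw i it; rewrite sw // /splice it.
rewrite -(fineK Pt) -!EFinM /splice leqnn ltnn; congr EFin.
by rewrite /= mulrCA mulrC (mulrC (mu D _ _)).
Qed.

(** * Comparison of the expected arrival time with a nonnegative function [k] of the state *)

Section Value.
Context (y : V) (pi : @policy V G y) (a : V) (g : snapshot G).

Let miss t : \bar R := (\int[P g]_w ((position pi a (X^~ w) t != y)%:R)%:E)%E.

Lemma miss_determined t : determined_upto t
  (fun s => (position pi a s t != y)%:R : R).
Proof. by move=> s s' /(@position_determined _ _ _ pi a t) ->. Qed.

Lemma expected_arrival_series :
  expected_arrival P X pi a g = (\sum_(0 <= t <oo) miss t)%E.
Proof.
rewrite /expected_arrival; under eq_integral do rewrite arrival_time_series.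
rewrite integral_nneseries // => t.
exact: (measurable_path_function mX (miss_determined (t := t))).
Qed.

Context (k : V -> snapshot G -> R) (k_ge0 : forall b g1, 0 <= k b g1).

Let value t : \bar R := (\int[P g]_w (k (position pi a (X^~ w) t) (X t w))%:E)%E.

Lemma value_determined t : determined_upto t
  (fun s => k (position pi a s t) (s t)).
Proof. by move=> s s' ss'; rewrite (position_determined _ _ ss') ss'. Qed.

Lemma value0 : value 0 = (k a g)%:E.
Proof.
rewrite /value (ae_eq_integral (cst (k a g)%:E)) //.
- by rewrite integral_cst // [X in (_ * X)%E]probability_setT mule1.
- exact: (measurable_path_function mX (value_determined (t := 0%N))).
(* The integrand can differ from [k a g] only where [X 0] is not [g], a null set by
   [process_init]. *)
exists (~` [set w | X 0%N w = g])%classic; split.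
- exact/measurableC/mX.
- by have := probability_setC (P g) (mX 0%N g); rewrite (process_init procX) subee.
- by move=> w /= nw xw; apply: nw => _; rewrite /position /= xw.
Qed.

(** The Bellman operator of [pi] applied to [k]: one unit of time off [y], plus the mean of [k]
    after one move. The past is an argument because [pi] may depend on it. *)
Let lookahead past b g1 : R := (b != y)%:R +
  \sum_h mu D g1 h * k (Defs.choose pi past b g1 h) h.

Lemma integral_lookahead t : (miss t + value t.+1 =
  \int[P g]_w (lookahead (run pi a (X^~ w) t).1 (position pi a (X^~ w) t)
                 (X t w))%:E)%E.
Proof.
rewrite /value (@integral_step _ t (fun s => k (position pi a s t.+1) (s t.+1))) //;
  last exact: value_determined.
pose F (s : nat -> snapshot G) := \sum_h mu D (s t) h *
  k (Defs.choose pi (run pi a s t).1 (position pi a s t) (s t) h) h.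
have Ft : determined_upto t F.
  by move=> s s' ss'; rewrite /F (run_determined _ _ ss') (position_determined _ _ ss') ss'.
rewrite (eq_integral (fun w => (F (X^~ w))%:E)) => [|w _]; last first.
  congr EFin; apply: eq_bigr => h _; rewrite position_next.
  (* The spliced sequence agrees with the trajectory up to [t], hence so do the run and the
     position; its value at [t.+1] is [h]. *)
  have sX i : (i <= t)%N -> splice (X^~ w) t h i = X i w by rewrite /splice => ->.
  by rewrite (run_determined _ _ sX) (position_determined _ _ sX) sX // /splice ltnn.
rewrite -ge0_integralD //.
- exact: (measurable_path_function mX (miss_determined (t := t))).
- by move=> w _; rewrite lee_fin sumr_ge0 // => h _; rewrite mulr_ge0 ?mu_ge0.
- exact: (measurable_path_function mX Ft).
Qed.


Let miss_ge0 t : (0 <= miss t)%E.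
Proof. by apply: integral_ge0 => w _; rewrite lee_fin ler0n. Qed.

Let value_ge0 t : (0 <= value t)%E.
Proof. by apply: integral_ge0 => w _; rewrite lee_fin. Qed.

(** Integrating the hypothesis along the run gives [value t <= miss t + value t.+1], which
    telescopes. *)
Lemma value_le_partial_sum t :
  (forall past b g1, k b g1 <= lookahead past b g1) ->
  ((k a g)%:E <= \sum_(0 <= s < t) miss s + value t)%E.
Proof.
move=> k_le; elim: t => [|t IH]; first by rewrite big_geq // add0e value0.
rewrite big_nat_recr //= -addeA; apply: le_trans IH _; rewrite leeD2l //.
rewrite integral_lookahead; apply: ge0_le_integral => //.
- by move=> w _; rewrite lee_fin.
- exact: (measurable_path_function mX (value_determined (t := t))).
- pose F (s : nat -> snapshot G) :=
    lookahead (run pi a s t).1 (position pi a s t) (s t).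
  have Ft : determined_upto t F.
    by move=> s s' ss'; rewrite /F (run_determined _ _ ss') (position_determined _ _ ss') ss'.
  exact: (measurable_path_function mX Ft).
- by move=> w _; rewrite lee_fin; exact: k_le.
Qed.

Lemma value_eq_partial_sum t :
  (forall past b g1, k b g1 = lookahead past b g1) ->
  ((k a g)%:E = \sum_(0 <= s < t) miss s + value t)%E.
Proof.
move=> k_eq; elim: t => [|t IH]; first by rewrite big_geq // add0e value0.
rewrite big_nat_recr //= -addeA IH integral_lookahead; congr (_ + _)%E.
by apply: eq_integral => w _; congr EFin; exact: k_eq.
Qed.

(** Every partial sum of misses is at most [k a g], since the remainder [value t] is nonnegative. *)
Lemma expected_arrival_le_value :
  (forall past b g1, k b g1 = lookahead past b g1) ->
  (expected_arrival P X pi a g <= (k a g)%:E)%E.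
Proof.
move=> k_eq; rewrite expected_arrival_series; apply: lime_le.
  exact: is_cvg_nneseries.
by apply: nearW => t; rewrite (value_eq_partial_sum t k_eq) leeDl.
Qed.

(** Pointwise: at [y] both integrands vanish, and elsewhere the sum of all values of [k] dominates
    each of them. *)
Lemma value_le_miss t : (forall g1, k y g1 = 0) ->
  (value t <= (\sum_b \sum_g1 k b g1)%:E * miss t)%E.
Proof.
move=> ky; have sk0 b : 0 <= \sum_g1 k b g1 by apply: sumr_ge0.
rewrite -ge0_integralZl_EFin ?sumr_ge0 //; last first.
  exact: (measurable_path_function mX (miss_determined (t := t))).
apply: ge0_le_integral => //.
- by move=> w _; rewrite lee_fin.
- exact: (measurable_path_function mX (value_determined (t := t))).
- apply: emeasurable_funM => //.
  exact: (measurable_path_function mX (miss_determined (t := t))).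
move=> w _; rewrite -EFinM lee_fin; set b := position _ _ _ _.
have [->|_] := eqVneq b y; first by rewrite ky mulr0.
rewrite mulr1 (bigD1 b) //= (bigD1 (X t w)) //= -addrA lerDl.
by rewrite addr_ge0 ?sumr_ge0.
Qed.

(* [value t] is at most a constant times [miss t], which is summable when the
   expected arrival time is finite, so it cannot stay bounded away from 0. *)
Lemma value_le_expected_arrival : (forall g1, k y g1 = 0) ->
  (forall past b g1, k b g1 <= lookahead past b g1) ->
  ((k a g)%:E <= expected_arrival P X pi a g)%E.
Proof.
move=> ky k_le; rewrite expected_arrival_series.
have partial n : (\sum_(0 <= s < n) miss s <= \sum_(0 <= t <oo) miss t)%E.
  exact: nneseries_lim_ge.
have step t := le_trans (value_le_partial_sum t k_le)
  (leeD (partial t) (value_le_miss t ky)).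
have: (0 <= \sum_(0 <= t <oo) miss t)%E by exact: nneseries_ge0.
(* Only a finite total [T] needs an argument; then [step t] reads [k a g <= T + C * miss t]. *)
case E : (\sum_(0 <= t <oo) miss t)%E partial step => [T| |] // partial step; last by move=> _; exact: leey.
rewrite !lee_fin => T0; set C := (\sum_b \sum_g1 k b g1) in step.
have C0 : 0 <= C by apply: sumr_ge0 => b _; apply: sumr_ge0.
have missE t : miss t = (fine (miss t))%:E.
  apply/esym/fineK; rewrite ge0_fin_numE //.
  apply: le_lt_trans (ltry T); apply: le_trans (partial t.+1).
    by rewrite big_nat_recr //= leeDr // sume_ge0.
rewrite leNgt; apply/negP => Tk; rewrite -subr_gt0 in Tk.
(* If [e > 0], then [e <= C * miss t] for every [t]; adding [n] of these gives [n * e <= C * T],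
   contrary to the choice of [n]. *)
set e := k a g - T in Tk; pose n := Num.Def.archi_bound (C * T / e).
have : C * T / e < n%:R by apply/archi_boundP/divr_ge0/ltW => //; exact: mulr_ge0.
rewrite ltr_pdivrMr //; apply/negP; rewrite -leNgt.
rewrite mulr_natl -[n in e *+ n]subn0 -sumr_const_nat.
apply: (@le_trans _ _ (C * \sum_(0 <= t < n) fine (miss t))).
  rewrite mulr_sumr; apply: ler_sum => t _.
  by have := step t; rewrite missE -EFinM -EFinD lee_fin lerBlDl.
apply: ler_wpM2l => //; rewrite -lee_fin -sumEFin.
by under eq_bigr do rewrite -missE; exact: partial.
Qed.
End Value.
End Process.

(** * Both bounds applied with [h'] as [k] *)

Theorem theorem11 (R : realType) (V : finType) (G : sgraph V)
  (D : memory1 R G)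
  (d : measure_display) (Om : measurableType d)
  (P : snapshot G -> probability Om R) (X : nat -> Om -> snapshot G)
  (procX : memory1_process D P X)
  (y : V)
  (sigma : seq (V * snapshot G)) (sigma_opt : is_optimal_ordering P X y sigma)
  (u : V -> snapshot G -> V)
  (u_first : forall a g1, is_first_neighbour sigma a g1 (u a g1))
  (h' : V -> snapshot G -> R)
  (h'_rec : forall a g0, a != y ->
     h' a g0 = 1 + \sum_(g1 : snapshot G) mu D g0 g1 * h' (u a g1) g1)
  (h'_min : forall a g1 v, a != y -> v \in closed_nbhd g1 a ->
     h' (u a g1) g1 <= h' v g1)
  (h'_ge0 : forall a g0, 0 <= h' a g0)
  (h'_target : forall g0, h' y g0 = 0) :
  forall a g0, (h' a g0)%:E = hopt P X a y g0.
Proof.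
move=> a g0; apply/le_anti/andP; split.
  (* Lower bound for an arbitrary policy: off [y], its move does no better than [u] by [h'_min]; at
     [y], [h'] is 0. *)
  apply/ereal_infP => _ [pi _ <-].
  apply: (value_le_expected_arrival procX) => // past b g1.
  have [->|b_y] := eqVneq b y.
    rewrite h'_target add0r sumr_ge0 // => h _.
    by rewrite mulr_ge0 // mu_ge0.
  rewrite h'_rec // lerD2l; apply: ler_sum => h _.
  by rewrite ler_wpM2l ?mu_ge0 // h'_min // choose_nbhd.
(* Upper bound by the policy that follows [u]; the test at [y] makes [choose_stay] hold by
   construction. *)
pose greedy (past : seq (V * snapshot G)) b (g g1 : snapshot G) :=
  if b == y then y else u b g1.
have greedy_nbhd past b g g1 : greedy past b g g1 \in closed_nbhd g1 b.
  by rewrite /greedy; case: eqP => [->|_]; [rewrite setU11 | case: (u_first b g1)].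
have greedy_stay past g g1 : greedy past y g g1 = y by rewrite /greedy eqxx.
apply: (@le_trans _ _ (expected_arrival P X (Policy greedy_nbhd greedy_stay) a g0)).
  by apply: ereal_inf_lbound; exists (Policy greedy_nbhd greedy_stay).
apply: (expected_arrival_le_value procX) => // past b g1 /=.
rewrite /greedy; have [->|b_y] := eqVneq b y; last exact: h'_rec.
by rewrite h'_target add0r big1 // => h _; rewrite h'_target mulr0.
Qed.
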